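(* Let $(B_1,B_2,\mu_l,\nu_l,\mu_r,\nu_r)$ be a Hopf datum in a (strict) braided monoidal category $\mathcal C$, let $B=B_1\otimes B_2$ with $\mathrm m_B=(\mathrm m_1\otimes\mathrm m_2)\circ(\mathrm{id}_1\otimes\phi_{2,1}\otimes\mathrm{id}_2)$ and $\Delta_B=(\mathrm{id}_1\otimes\phi_{1,2}\otimes\mathrm{id}_2)\circ(\Delta_1\otimes\Delta_2)$, and consider the endomorphisms of $B_1\otimes B_2\otimes B_1\otimes B_2=B\otimes B$ $$f_1:=\Delta_B\circ\mathrm m_B,\qquad f_2:=(\mathrm m_B\otimes\mathrm m_B)\circ(\mathrm{id}_B\otimes\Psi_{B,B}\otimes\mathrm{id}_B)\circ(\Delta_B\otimes\Delta_B).$$ Then $f_1=\Phi(f_1)$ and $f_2=\Phi(f_2)$.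
   Context: $\mathcal C$ has tensor product $\otimes$, unit object $I$, braiding $\Psi$, and idempotents in $\mathcal C$ split. Algebras are unital associative, coalgebras counital coassociative. Write $\mathrm{id}_j=\mathrm{id}_{B_j}$, $\Psi_{i,j}=\Psi_{B_i,B_j}$. Hopf datum. A Hopf datum $(B_1,B_2,\mu_l,\nu_l,\mu_r,\nu_r)$ consists of objects $B_1,B_2$, each an algebra $(\mathrm m_j,\eta_j)$ and a coalgebra $(\Delta_j,\varepsilon_j)$ such that $\varepsilon_j$ is an algebra morphism and $\eta_j$ is a coalgebra morphism; a left $B_2$-module structure $\mu_l:B_2\otimes B_1\to B_1$ and a left $B_2$-comodule structure $\nu_l:B_1\to B_2\otimes B_1$ on $B_1$; a right $B_1$-module structure $\mu_r:B_2\otimes B_1\to B_2$ and a right $B_1$-comodule structure $\nu_r:B_2\to B_2\otimes B_1$ on $B_2$. Put $\phi_{1,2}=(\mathrm m_2\otimes\mathrm m_1)\circ(\mathrm{id}_2\otimes\Psi_{1,2}\otimes\mathrm{id}_1)\circ(\nu_l\otimes\nu_r)$ and $\phi_{2,1}=(\mu_l\otimes\mu_r)\circ(\mathrm{id}_2\otimes\Psi_{2,1}\otimes\mathrm{id}_1)\circ(\Delta_2\otimes\Delta_1)$. Required identities: - $\mu_r\circ(\eta_2\otimes\mathrm{id}_1)=\eta_2\circ\varepsilon_1=(\mathrm{id}_2\otimes\varepsilon_1)\circ\nu_l$; $\varepsilon_2\circ\mu_r=\varepsilon_2\otimes\varepsilon_1=\varepsilon_1\circ\mu_l$; $\mu_l\circ(\mathrm{id}_2\otimes\eta_1)=\eta_1\circ\varepsilon_2=(\varepsilon_2\otimes\mathrm{id}_1)\circ\nu_r$;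 $\nu_r\circ\eta_2=\eta_2\otimes\eta_1=\nu_l\circ\eta_1$. - Algebra-coalgebra: $\Delta_1\mathrm m_1=(\mathrm m_1\otimes\mathrm m_1)\circ(\mathrm{id}_1\otimes\mu_l\otimes\mathrm{id}_1\otimes\mathrm{id}_1)\circ(\mathrm{id}_1\otimes\mathrm{id}_2\otimes\Psi_{1,1}\otimes\mathrm{id}_1)\circ(\mathrm{id}_1\otimes\nu_l\otimes\mathrm{id}_1\otimes\mathrm{id}_1)\circ(\Delta_1\otimes\Delta_1)$ and $\Delta_2\mathrm m_2=(\mathrm m_2\otimes\mathrm m_2)\circ(\mathrm{id}_2\otimes\mathrm{id}_2\otimes\mu_r\otimes\mathrm{id}_2)\circ(\mathrm{id}_2\otimes\Psi_{2,2}\otimes\mathrm{id}_1\otimes\mathrm{id}_2)\circ(\mathrm{id}_2\otimes\mathrm{id}_2\otimes\nu_r\otimes\mathrm{id}_2)\circ(\Delta_2\otimes\Delta_2)$. - Module-comodule: $\phi_{1,2}\circ\phi_{2,1}=(\mathrm m_2\otimes\mathrm m_1)\circ(\mu_r\otimes\Psi_{1,2}\otimes\mu_l)\circ(\mathrm{id}_2\otimes\Psi_{1,1}\otimes\Psi_{2,2}\otimes\mathrm{id}_1)\circ(\nu_r\otimes\Psi_{2,1}\otimes\nu_l)\circ(\Delta_2\otimes\Delta_1)$. - Module-algebra: $\mu_r(\mathrm m_2\otimes\mathrm{id}_1)=\mathrm m_2(\mu_r\otimes\mathrm{id}_2)(\mathrm{id}_2\otimes\phi_{2,1})$; $\mu_l(\mathrm{id}_2\otimes\mathrm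 m_1)=\mathrm m_1(\mathrm{id}_1\otimes\mu_l)(\phi_{2,1}\otimes\mathrm{id}_1)$. - Comodule-coalgebra: $(\Delta_2\otimes\mathrm{id}_1)\nu_r=(\mathrm{id}_2\otimes\phi_{1,2})(\nu_r\otimes\mathrm{id}_2)\Delta_2$; $(\mathrm{id}_2\otimes\Delta_1)\nu_l=(\phi_{1,2}\otimes\mathrm{id}_1)(\mathrm{id}_1\otimes\nu_l)\Delta_1$. - Module-coalgebra: $\Delta_2\mu_r=(\mathrm m_2\otimes\mu_r)(\mu_r\otimes\Psi_{2,2}\otimes\mathrm{id}_1)(\mathrm{id}_2\otimes\Psi_{2,1}\otimes\nu_l)(\Delta_2\otimes\Delta_1)$; $\Delta_1\mu_l=(\mu_l\otimes\mathrm m_1)(\mathrm{id}_2\otimes\Psi_{1,1}\otimes\mu_l)(\nu_r\otimes\Psi_{2,1}\otimes\mathrm{id}_1)(\Delta_2\otimes\Delta_1)$. - Comodule-algebra: $\nu_r\mathrm m_2=(\mathrm m_2\otimes\mathrm m_1)(\mathrm{id}_2\otimes\Psi_{1,2}\otimes\mu_l)(\nu_r\otimes\Psi_{2,2}\otimes\mathrm{id}_1)(\Delta_2\otimes\nu_r)$; $\nu_l\mathrm m_1=(\mathrm m_2\otimes\mathrm m_1)(\mu_r\otimes\Psi_{1,2}\otimes\mathrm{id}_1)(\mathrm{id}_2\otimes\Psi_{1,1}\otimes\nu_l)(\nu_l\otimes\Delta_1)$. The map $\Phi$. For $f\in\mathrm{End}_{\mathcal C}(B_1\otimes B_2\otimes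 B_1\otimes B_2)$, $\Phi(f)\in\mathrm{End}_{\mathcal C}(B_1\otimes B_2\otimes B_1\otimes B_2)$ is $$\Phi(f)=(L'\otimes Q\otimes R')\circ(\mathrm{id}_1\otimes\mathrm{id}_2\otimes\Psi_{1,1}\otimes f\otimes\Psi_{2,2}\otimes\mathrm{id}_1\otimes\mathrm{id}_2)\circ(L\otimes P\otimes R),$$ where $L=(\mathrm{id}_1\otimes\nu_l)\circ\Delta_1$, $R=(\nu_r\otimes\mathrm{id}_2)\circ\Delta_2$, $L'=\mathrm m_1\circ(\mathrm{id}_1\otimes\mu_l)$, $R'=\mathrm m_2\circ(\mu_r\otimes\mathrm{id}_2)$, $P:B_2\otimes B_1\to B_1\otimes B_1\otimes B_2\otimes B_1\otimes B_2\otimes B_2$, $$P=(\mu_l\otimes\mathrm{id}_1\otimes\mathrm{id}_2\otimes\mathrm{id}_1\otimes\mathrm{id}_2\otimes\mu_r)\circ(\mathrm{id}_2\otimes\Psi_{1,1}\otimes\mathrm{id}_2\otimes\mathrm{id}_1\otimes\Psi_{2,2}\otimes\mathrm{id}_1)\circ(\nu_r\otimes\Psi_{2,1}\otimes\Psi_{2,1}\otimes\nu_l)\circ(\Delta_2\otimes\Psi_{2,1}\otimes\Delta_1)\circ(\Delta_2\otimes\Delta_1),$$ and $Q:B_1\otimes B_1\otimes B_2\otimes B_1\otimes B_2\otimes B_2\to B_2\otimes B_1$, $$Q=(\mathrm m_2\otimes\mathrm m_1)\circ(\mathrm m_2\otimes\Psi_{1,2}\otimes\mathrm m_1)\circ(\mu_r\otimes\Psi_{1,2}\otimes\Psi_{1,2}\otimes\mu_l)\circ(\mathrm{id}_2\otimes\Psi_{1,1}\otimes\mathrm{id}_2\otimes\mathrm{id}_1\otimes\Psi_{2,2}\otimes\mathrm{id}_1)\circ(\nu_l\otimes\mathrm{id}_1\otimes\mathrm{id}_2\otimes\mathrm{id}_1\otimes\mathrm{id}_2\otimes\nu_r).$$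 *)

(* Defs.v *)
From mathcomp Require Import all_boot.

Set Implicit Arguments.
Unset Strict Implicit.
Unset Printing Implicit Defensive.

Declare Scope cat_scope.
Delimit Scope cat_scope with cat.
Local Open Scope cat_scope.

Record category := Category {
  obj :> Type;
  hom : obj -> obj -> Type;
  idm : forall a, hom a a;
  compm : forall a b c, hom b c -> hom a b -> hom a c;
  compA : forall a b c d (h : hom c d) (g : hom b c) (f : hom a b),
    compm h (compm g f) = compm (compm h g) f;
  comp1m : forall a b (f : hom a b), compm (idm b) f = f;
  compm1 : forall a b (f : hom a b), compm f (idm a) = f
}.
Arguments idm {_} _.

Definition idempotents_split (C : category) : Prop :=
  forall (a : C) (e : hom a a), compm e e = e ->
  exists (b : C) (p : hom a b) (i : hom b a), compm i p = e /\ compm p i = idm b.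

Definition hcast (C : category) (a a' b b' : C) (p : a = a') (q : b = b')
    (f : hom a b) : hom a' b' :=
  match p in _ = x, q in _ = y return hom x y with erefl, erefl => f end.

(* Strictness: associativity and unitality of the tensor product are equalities
   of objects; the corresponding equalities of morphisms hold up to transport
   along them. *)
Record strict_monoidal := StrictMonoidal {
  smcat :> category;
  unit_obj : smcat;
  tobj : smcat -> smcat -> smcat;
  thom : forall a b c d : smcat,
    hom a b -> hom c d -> hom (tobj a c) (tobj b d);
  thom_id : forall a b : smcat, thom (idm a) (idm b) = idm (tobj a b);
  thom_comp : forall (a b c a' b' c' : smcat) (g : hom b c) (f : hom a b)
      (g' : hom b' c') (f' : hom a' b'),
    thom (compm g f) (compm g' f') = compm (thom g g') (thom f f');
  tobjA : associative tobj;
  tobj1x : left_id unit_obj tobj;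
  tobjx1 : right_id unit_obj tobj;
  thomA : forall (a a' b b' c c' : smcat) (f : hom a a') (g : hom b b')
      (h : hom c c'),
    hcast (tobjA a b c) (tobjA a' b' c') (thom f (thom g h))
    = thom (thom f g) h;
  thom1m : forall (a b : smcat) (f : hom a b),
    hcast (tobj1x a) (tobj1x b) (thom (idm unit_obj) f) = f;
  thomm1 : forall (a b : smcat) (f : hom a b),
    hcast (tobjx1 a) (tobjx1 b) (thom f (idm unit_obj)) = f
}.
Arguments unit_obj {_}.
Arguments tobj {_} _ _.

Record strict_braided := StrictBraided {
  sbcat :> strict_monoidal;
  braid : forall a b : sbcat, hom (tobj a b) (tobj b a);
  braidV : forall a b : sbcat, hom (tobj b a) (tobj a b);
  braidK : forall a b : sbcat, compm (braidV a b) (braid a b) = idm (tobj a b);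
  braidVK : forall a b : sbcat, compm (braid a b) (braidV a b) = idm (tobj b a);
  braid_nat : forall (a a' b b' : sbcat) (f : hom a a') (g : hom b b'),
    compm (braid a' b') (thom f g) = compm (thom g f) (braid a b);
  (* Psi_{a, b (x) c} = (id_b (x) Psi_{a,c}) o (Psi_{a,b} (x) id_c) *)
  braid_hexr : forall a b c : sbcat,
    hcast erefl (esym (tobjA b c a)) (braid a (tobj b c))
    = compm (thom (idm b) (braid a c))
        (hcast (esym (tobjA a b c)) (esym (tobjA b a c))
           (thom (braid a b) (idm c)));
  (* Psi_{a (x) b, c} = (Psi_{a,c} (x) id_b) o (id_a (x) Psi_{b,c}) *)
  braid_hexl : forall a b c : sbcat,
    hcast erefl (tobjA c a b) (braid (tobj a b) c)
    = compm (thom (braid a c) (idm b))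
        (hcast (tobjA a b c) (tobjA a c b) (thom (idm a) (braid b c)))
}.

(* Morphisms between iterated tensor products are written as morphisms between
   words of objects: tens [:: x1; ...; xn] = x1 (x) (x2 (x) (... (x) xn)).
   On words without variables the associativity and unitality of concatenation
   hold by conversion, so that formulas of a strict monoidal category typecheck
   without casts; the only transport is along tens_cat. *)
Section Words.
Variable C : strict_braided.
Implicit Types (x : C) (u v w : seq C).

Fixpoint tens w : C :=
  match w with
  | [::] => unit_obj
  | x :: w' => if w' is [::] then x else tobj x (tens w')
  end.

Lemma tens_cat u v : tens (u ++ v) = tobj (tens u) (tens v).
Proof.
elim: u => [|x [|y u] IHu]; first exact: esym (tobj1x _).
  by case: v {IHu} => [|y v]; [exact: esym (tobjx1 _) | exact: erefl].
exact: etrans (congr1 (tobj x) IHu) (tobjA _ _ _).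
Defined.

Definition whom u v : Type := hom (tens u) (tens v).

Definition wid w : whom w w := idm (tens w).

Definition wcomp u v w (g : whom v w) (f : whom u v) : whom u w := compm g f.

Definition wtens u v u' v' (f : whom u v) (g : whom u' v') :
    whom (u ++ u') (v ++ v') :=
  hcast (esym (tens_cat u u')) (esym (tens_cat v v')) (thom f g).

Definition wbraid u v : whom (u ++ v) (v ++ u) :=
  hcast (esym (tens_cat u v)) (esym (tens_cat v u)) (braid (tens u) (tens v)).

End Words.

Notation "f ⊗ g" := (wtens f g) (at level 35, right associativity) : cat_scope.
Notation "g ∘ f" := (wcomp g f) (at level 40, left associativity) : cat_scope.

Record algebra (C : strict_braided) (A : C) := Algebra {
  mul : whom [:: A; A] [:: A];
  one : whom [::] [:: A];
  mul_assoc : mul ∘ (mul ⊗ wid [:: A]) = mul ∘ (wid [:: A] ⊗ mul);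
  mul_onel : mul ∘ (one ⊗ wid [:: A]) = wid [:: A];
  mul_oner : mul ∘ (wid [:: A] ⊗ one) = wid [:: A]
}.

Record coalgebra (C : strict_braided) (A : C) := Coalgebra {
  comul : whom [:: A] [:: A; A];
  counit : whom [:: A] [::];
  comul_assoc : (comul ⊗ wid [:: A]) ∘ comul = (wid [:: A] ⊗ comul) ∘ comul;
  comul_counitl : (counit ⊗ wid [:: A]) ∘ comul = wid [:: A];
  comul_counitr : (wid [:: A] ⊗ counit) ∘ comul = wid [:: A]
}.

Section Structures.
Variables (C : strict_braided) (H X : C).

Definition counit_alg_morphism (a : algebra H) (c : coalgebra H) : Prop :=
  counit c ∘ mul a = counit c ⊗ counit c /\ counit c ∘ one a = wid [::].

Definition unit_coalg_morphism (a : algebra H) (c : coalgebra H) : Prop :=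
  comul c ∘ one a = one a ⊗ one a /\ counit c ∘ one a = wid [::].

Definition left_module (a : algebra H) (act : whom [:: H; X] [:: X]) : Prop :=
  act ∘ (mul a ⊗ wid [:: X]) = act ∘ (wid [:: H] ⊗ act)
  /\ act ∘ (one a ⊗ wid [:: X]) = wid [:: X].

Definition right_module (a : algebra H) (act : whom [:: X; H] [:: X]) : Prop :=
  act ∘ (wid [:: X] ⊗ mul a) = act ∘ (act ⊗ wid [:: H])
  /\ act ∘ (wid [:: X] ⊗ one a) = wid [:: X].

Definition left_comodule (c : coalgebra H) (coact : whom [:: X] [:: H; X])
    : Prop :=
  (comul c ⊗ wid [:: X]) ∘ coact = (wid [:: H] ⊗ coact) ∘ coact
  /\ (counit c ⊗ wid [:: X]) ∘ coact = wid [:: X].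

Definition right_comodule (c : coalgebra H) (coact : whom [:: X] [:: X; H])
    : Prop :=
  (wid [:: X] ⊗ comul c) ∘ coact = (coact ⊗ wid [:: H]) ∘ coact
  /\ (wid [:: X] ⊗ counit c) ∘ coact = wid [:: X].

End Structures.

Record hopf_data (C : strict_braided) (B1 B2 : C) := HopfData {
  alg1 : algebra B1;
  coalg1 : coalgebra B1;
  alg2 : algebra B2;
  coalg2 : coalgebra B2;
  mu_l : whom [:: B2; B1] [:: B1];
  nu_l : whom [:: B1] [:: B2; B1];
  mu_r : whom [:: B2; B1] [:: B2];
  nu_r : whom [:: B2] [:: B2; B1]
}.

Section HopfDatum.
Variables (C : strict_braided) (B1 B2 : C) (D : hopf_data B1 B2).

Local Notation id1 := (wid [:: B1]).
Local Notation id2 := (wid [:: B2]).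
Local Notation Ψ11 := (wbraid [:: B1] [:: B1]).
Local Notation Ψ12 := (wbraid [:: B1] [:: B2]).
Local Notation Ψ21 := (wbraid [:: B2] [:: B1]).
Local Notation Ψ22 := (wbraid [:: B2] [:: B2]).
Local Notation m1 := (mul (alg1 D)).
Local Notation m2 := (mul (alg2 D)).
Local Notation η1 := (one (alg1 D)).
Local Notation η2 := (one (alg2 D)).
Local Notation Δ1 := (comul (coalg1 D)).
Local Notation Δ2 := (comul (coalg2 D)).
Local Notation ε1 := (counit (coalg1 D)).
Local Notation ε2 := (counit (coalg2 D)).
Local Notation μl := (mu_l D).
Local Notation νl := (nu_l D).
Local Notation μr := (mu_r D).
Local Notation νr := (nu_r D).

Definition phi12 : whom [:: B1; B2] [:: B2; B1] :=
  (m2 ⊗ m1) ∘ (id2 ⊗ Ψ12 ⊗ id1) ∘ (νl ⊗ νr).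

Definition phi21 : whom [:: B2; B1] [:: B1; B2] :=
  (μl ⊗ μr) ∘ (id2 ⊗ Ψ21 ⊗ id1) ∘ (Δ2 ⊗ Δ1).

Record is_hopf_datum : Prop := IsHopfDatum {
  eps1_alg : counit_alg_morphism (alg1 D) (coalg1 D);
  eps2_alg : counit_alg_morphism (alg2 D) (coalg2 D);
  eta1_coalg : unit_coalg_morphism (alg1 D) (coalg1 D);
  eta2_coalg : unit_coalg_morphism (alg2 D) (coalg2 D);
  mu_l_module : left_module (alg2 D) μl;
  nu_l_comodule : left_comodule (coalg2 D) νl;
  mu_r_module : right_module (alg1 D) μr;
  nu_r_comodule : right_comodule (coalg1 D) νr;
  mu_r_eta2 : μr ∘ (η2 ⊗ id1) = η2 ∘ ε1;
  eps1_nu_l : η2 ∘ ε1 = (id2 ⊗ ε1) ∘ νl;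
  eps2_mu_r : ε2 ∘ μr = ε2 ⊗ ε1;
  eps1_mu_l : ε2 ⊗ ε1 = ε1 ∘ μl;
  mu_l_eta1 : μl ∘ (id2 ⊗ η1) = η1 ∘ ε2;
  eps2_nu_r : η1 ∘ ε2 = (ε2 ⊗ id1) ∘ νr;
  nu_r_eta2 : νr ∘ η2 = η2 ⊗ η1;
  nu_l_eta1 : η2 ⊗ η1 = νl ∘ η1;
  algebra_coalgebra1 :
    Δ1 ∘ m1 = (m1 ⊗ m1) ∘ (id1 ⊗ μl ⊗ id1 ⊗ id1) ∘ (id1 ⊗ id2 ⊗ Ψ11 ⊗ id1)
              ∘ (id1 ⊗ νl ⊗ id1 ⊗ id1) ∘ (Δ1 ⊗ Δ1);
  algebra_coalgebra2 :
    Δ2 ∘ m2 = (m2 ⊗ m2) ∘ (id2 ⊗ id2 ⊗ μr ⊗ id2) ∘ (id2 ⊗ Ψ22 ⊗ id1 ⊗ id2)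
              ∘ (id2 ⊗ id2 ⊗ νr ⊗ id2) ∘ (Δ2 ⊗ Δ2);
  module_comodule :
    phi12 ∘ phi21 = (m2 ⊗ m1) ∘ (μr ⊗ Ψ12 ⊗ μl) ∘ (id2 ⊗ Ψ11 ⊗ Ψ22 ⊗ id1)
                    ∘ (νr ⊗ Ψ21 ⊗ νl) ∘ (Δ2 ⊗ Δ1);
  module_algebra_r : μr ∘ (m2 ⊗ id1) = m2 ∘ (μr ⊗ id2) ∘ (id2 ⊗ phi21);
  module_algebra_l : μl ∘ (id2 ⊗ m1) = m1 ∘ (id1 ⊗ μl) ∘ (phi21 ⊗ id1);
  comodule_coalgebra_r : (Δ2 ⊗ id1) ∘ νr = (id2 ⊗ phi12) ∘ (νr ⊗ id2) ∘ Δ2;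
  comodule_coalgebra_l : (id2 ⊗ Δ1) ∘ νl = (phi12 ⊗ id1) ∘ (id1 ⊗ νl) ∘ Δ1;
  module_coalgebra_r :
    Δ2 ∘ μr = (m2 ⊗ μr) ∘ (μr ⊗ Ψ22 ⊗ id1) ∘ (id2 ⊗ Ψ21 ⊗ νl) ∘ (Δ2 ⊗ Δ1);
  module_coalgebra_l :
    Δ1 ∘ μl = (μl ⊗ m1) ∘ (id2 ⊗ Ψ11 ⊗ μl) ∘ (νr ⊗ Ψ21 ⊗ id1) ∘ (Δ2 ⊗ Δ1);
  comodule_algebra_r :
    νr ∘ m2 = (m2 ⊗ m1) ∘ (id2 ⊗ Ψ12 ⊗ μl) ∘ (νr ⊗ Ψ22 ⊗ id1) ∘ (Δ2 ⊗ νr);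
  comodule_algebra_l :
    νl ∘ m1 = (m2 ⊗ m1) ∘ (μr ⊗ Ψ12 ⊗ id1) ∘ (id2 ⊗ Ψ11 ⊗ νl) ∘ (νl ⊗ Δ1)
}.

Local Notation B := [:: B1; B2].

Definition mB : whom (B ++ B) B := (m1 ⊗ m2) ∘ (id1 ⊗ phi21 ⊗ id2).

Definition DeltaB : whom B (B ++ B) := (id1 ⊗ phi12 ⊗ id2) ∘ (Δ1 ⊗ Δ2).

Definition mapL : whom [:: B1] [:: B1; B2; B1] := (id1 ⊗ νl) ∘ Δ1.

Definition mapR : whom [:: B2] [:: B2; B1; B2] := (νr ⊗ id2) ∘ Δ2.

Definition mapL' : whom [:: B1; B2; B1] [:: B1] := m1 ∘ (id1 ⊗ μl).

Definition mapR' : whom [:: B2; B1; B2] [:: B2] := m2 ∘ (μr ⊗ id2).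

Definition mapP : whom [:: B2; B1] [:: B1; B1; B2; B1; B2; B2] :=
  (μl ⊗ id1 ⊗ id2 ⊗ id1 ⊗ id2 ⊗ μr)
  ∘ (id2 ⊗ Ψ11 ⊗ id2 ⊗ id1 ⊗ Ψ22 ⊗ id1)
  ∘ (νr ⊗ Ψ21 ⊗ Ψ21 ⊗ νl)
  ∘ (Δ2 ⊗ Ψ21 ⊗ Δ1)
  ∘ (Δ2 ⊗ Δ1).

Definition mapQ : whom [:: B1; B1; B2; B1; B2; B2] [:: B2; B1] :=
  (m2 ⊗ m1)
  ∘ (m2 ⊗ Ψ12 ⊗ m1)
  ∘ (μr ⊗ Ψ12 ⊗ Ψ12 ⊗ μl)
  ∘ (id2 ⊗ Ψ11 ⊗ id2 ⊗ id1 ⊗ Ψ22 ⊗ id1)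
  ∘ (νl ⊗ id1 ⊗ id2 ⊗ id1 ⊗ id2 ⊗ νr).

Definition Phi (f : whom (B ++ B) (B ++ B)) : whom (B ++ B) (B ++ B) :=
  (mapL' ⊗ mapQ ⊗ mapR')
  ∘ (id1 ⊗ id2 ⊗ Ψ11 ⊗ f ⊗ Ψ22 ⊗ id1 ⊗ id2)
  ∘ (mapL ⊗ mapP ⊗ mapR).

End HopfDatum.

(* Main.v *)
(* Both identities are calculations with string diagrams, which are written here
   in Sweedler notation: a, x, b, y stand for elements of B1, B2, B1, B2, while
   <a, x> stands for phi12 and < for mu_r.

   f1: the algebra-coalgebra axioms put Delta_B m_B in the form
   L' (x) K (x) R' after L (x) K' (x) R with K = phi12 (m1 (x) m2) and
   K' = (Delta1 (x) Delta2) phi21. The comodule-algebra axioms give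
   K = Q (id (x) Delta_B (x) id), the module-coalgebra axioms give
   K' = (id (x) m_B (x) id) P, and in between Delta_B m_B reappears.

   f2: the second factor of f2 is (u_2 < b) w with (u, v) = <a, x>, and the
   coproduct of u is computed from the algebra-coalgebra and
   comodule-coalgebra axioms: it is the product of a_(-1) and x_1(0), followed
   by (a_(0)(-1) < x_1(1)_1) pi, where (pi, rho) = <x_1(1)_2, x_2>. The
   module-algebra axiom for (A pi) < b then produces phi21 of (pi_1, b), which
   rebuilds the inner copy of f2. The other half is the mirror image.

   The isotopies are decided by computation: a diagram is a list of elementary
   layers, rewritten with the naturality of the braiding and with the axioms,
   each rewriting step being sound in any strict braided category. *)

From Stdlib Require Import ProofIrrelevance.
From HB Require Import structures.
Require Import Defs.
From mathcomp Require Import all_boot.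
Local Open Scope cat_scope.

Set Implicit Arguments.
Unset Strict Implicit.
Unset Printing Implicit Defensive.

(** * Heterogeneous equality of morphisms *)

Section HeterogeneousEquality.
Variable C : category.

(** Strictness gives equations only up to transport of the endpoints. Hiding the two object
    equalities lets such equations be chained without tracking casts. *)
Definition hsim (a b a' b' : C) (f : hom a b) (g : hom a' b') : Prop :=
  exists (p : a = a') (q : b = b'), hcast p q f = g.

Lemma hsim_refl (a b : C) (f : hom a b) : hsim f f.
Proof. by exists erefl, erefl. Qed.

Lemma hsim_sym (a b a' b' : C) (f : hom a b) (g : hom a' b') :
  hsim f g -> hsim g f.
Proof. by case=> p [q <-]; case: _ / p; case: _ / q; apply: hsim_refl. Qed.

Lemma hsim_trans (a b a' b' a'' b'' : C) (f : hom a b) (g : hom a' b')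
    (h : hom a'' b'') : hsim f g -> hsim g h -> hsim f h.
Proof. by case=> p [q <-]; case: _ / p; case: _ / q. Qed.

Lemma hsim_hcast (a b a' b' : C) (p : a = a') (q : b = b') (f : hom a b) :
  hsim (hcast p q f) f.
Proof. by case: _ / p; case: _ / q; apply: hsim_refl. Qed.

(** Proof irrelevance makes every proof of [a = a] trivial, for an arbitrary type of objects. *)
Lemma hsim_eq (a b : C) (f g : hom a b) : hsim f g -> f = g.
Proof.
case=> p [q <-].
by rewrite (proof_irrelevance _ p erefl) (proof_irrelevance _ q erefl).
Qed.

Lemma hsim_comp (a b c a' b' c' : C) (g : hom b c) (f : hom a b)
    (g' : hom b' c') (f' : hom a' b') :
  hsim g g' -> hsim f f' -> hsim (compm g f) (compm g' f').
Proof.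
case=> p [q <-]; case: _ / q g'; case: _ / p f' => f' _.
case=> p [q <-]; case: _ / p f'.
by rewrite (proof_irrelevance _ q erefl) => _; apply: hsim_refl.
Qed.

Lemma hsim_id (a b : C) : a = b -> hsim (idm a) (idm b).
Proof. by move=> e; case: _ / e; apply: hsim_refl. Qed.

End HeterogeneousEquality.

Local Notation "f ≃ g" := (hsim f g) (at level 70).

(** * Tensor product and braiding up to transport *)

Section StrictTensor.
Variable C : strict_braided.

Lemma hsim_thom (a b c d a' b' c' d' : C) (f : hom a b) (g : hom c d)
    (f' : hom a' b') (g' : hom c' d') :
  f ≃ f' -> g ≃ g' -> thom f g ≃ thom f' g'.
Proof.
case=> p [q <-]; case: _ / p; case: _ / q; case=> p [q <-].
by case: _ / p; case: _ / q; apply: hsim_refl.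
Qed.

Lemma hsim_thomA (a a' b b' c c' : C) (f : hom a a') (g : hom b b')
    (h : hom c c') : thom f (thom g h) ≃ thom (thom f g) h.
Proof. by exists (tobjA a b c), (tobjA a' b' c'); apply: thomA. Qed.

Lemma hsim_thom1m (a b : C) (f : hom a b) : thom (idm unit_obj) f ≃ f.
Proof. by exists (tobj1x a), (tobj1x b); apply: thom1m. Qed.

Lemma hsim_thomm1 (a b : C) (f : hom a b) : thom f (idm unit_obj) ≃ f.
Proof. by exists (tobjx1 a), (tobjx1 b); apply: thomm1. Qed.

Lemma hsim_braid (a b a' b' : C) :
  a = a' -> b = b' -> braid a b ≃ braid a' b'.
Proof. by move=> p q; case: _ / p; case: _ / q; apply: hsim_refl. Qed.

Lemma braid_hexr_sim (a b c : C)
    (f : hom (tobj a (tobj b c)) (tobj b (tobj a c))) :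
  f ≃ thom (braid a b) (idm c) ->
  braid a (tobj b c) ≃ compm (thom (idm b) (braid a c)) f.
Proof.
move=> Ef.
apply: hsim_trans (hsim_sym (hsim_hcast erefl (esym (tobjA b c a)) _)) _.
rewrite braid_hexr; apply: hsim_comp; first exact: hsim_refl.
exact: hsim_trans (hsim_hcast _ _ _) (hsim_sym Ef).
Qed.

Lemma braid_hexl_sim (a b c : C)
    (f : hom (tobj (tobj a b) c) (tobj (tobj a c) b)) :
  f ≃ thom (idm a) (braid b c) ->
  braid (tobj a b) c ≃ compm (thom (braid a c) (idm b)) f.
Proof.
move=> Ef.
apply: hsim_trans (hsim_sym (hsim_hcast erefl (tobjA c a b) _)) _.
rewrite braid_hexl; apply: hsim_comp; first exact: hsim_refl.
exact: hsim_trans (hsim_hcast _ _ _) (hsim_sym Ef).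
Qed.

Lemma idempotent_iso_id (a b c : C) (f : hom a b) (g : hom b a) (e : hom c c) :
  compm g f = idm a -> f ≃ e -> e = compm e e -> e = idm c.
Proof.
move=> gf [p [q fe]] ee; subst c b; rewrite /= in fe; subst e.
by rewrite -gf [in RHS]ee Defs.compA gf comp1m.
Qed.

(* By the hexagon axiom the braiding with the unit is idempotent. *)
Lemma braid_unitr (a : C) : braid a unit_obj ≃ idm a.
Proof.
(* Self-composition makes sense only after transporting the braiding to an endomorphism [e] of
   [a]. *)
have /= [e Ee] : exists e : hom a a, braid a unit_obj ≃ e.
  exists (hcast (tobjx1 a) (tobj1x a) (braid a unit_obj)).
  exact: hsim_sym (hsim_hcast _ _ _).
suff ee : e = compm e e by rewrite -(idempotent_iso_id (braidK _ _) Ee ee).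
have aII : a = tobj a (tobj unit_obj unit_obj) by rewrite !tobjx1.
have IaI : a = tobj unit_obj (tobj a unit_obj) by rewrite tobj1x tobjx1.
apply: hsim_eq; apply: hsim_trans (hsim_sym Ee) _.
(* Replacing [unit_obj] by its tensor square makes both factors of the hexagon transports of [e]. *)
apply: hsim_trans (hsim_braid erefl (esym (tobjx1 unit_obj))) _.
apply: hsim_trans (braid_hexr_sim (f := hcast aII IaI e) _) _.
  apply: hsim_trans (hsim_hcast _ _ _) _.
  exact: hsim_trans (hsim_sym Ee) (hsim_sym (hsim_thomm1 _)).
apply: hsim_comp; last exact: hsim_hcast.
exact: hsim_trans (hsim_thom1m _) Ee.
Qed.

Lemma braid_unitl (a : C) : braid unit_obj a ≃ idm a.
Proof.
have /= [e Ee] : exists e : hom a a, braid unit_obj a ≃ e.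
  exists (hcast (tobj1x a) (tobjx1 a) (braid unit_obj a)).
  exact: hsim_sym (hsim_hcast _ _ _).
suff ee : e = compm e e by rewrite -(idempotent_iso_id (braidK _ _) Ee ee).
have IIa : a = tobj (tobj unit_obj unit_obj) a by rewrite !tobj1x.
have IaI : a = tobj (tobj unit_obj a) unit_obj by rewrite tobj1x tobjx1.
apply: hsim_eq; apply: hsim_trans (hsim_sym Ee) _.
apply: hsim_trans (hsim_braid (esym (tobjx1 unit_obj)) erefl) _.
apply: hsim_trans (braid_hexl_sim (f := hcast IIa IaI e) _) _.
  apply: hsim_trans (hsim_hcast _ _ _) _.
  exact: hsim_trans (hsim_sym Ee) (hsim_sym (hsim_thom1m _)).
apply: hsim_comp; last exact: hsim_hcast.
exact: hsim_trans (hsim_thomm1 _) Ee.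
Qed.

End StrictTensor.

(** * Strict monoidal laws for words of labelled strands *)

Section LabelledWords.
Variables (C : strict_braided) (L : Type) (rho : L -> C).
Implicit Types u v w : seq L.

Definition whomL u v : Type := whom (map rho u) (map rho v).

(* Transparent, so that the transports in [htens] and [hbraid] compute away on
   closed words. *)
Fixpoint map_catL u v : map rho (u ++ v) = map rho u ++ map rho v :=
  if u is x :: u' then congr1 (cons (rho x)) (map_catL u' v) else erefl.

Definition wcast (u u' v v' : seq C) (p : u = u') (q : v = v')
    (f : whom u v) : whom u' v' :=
  match p in _ = x, q in _ = y return whom x y with erefl, erefl => f end.

Definition hid u : whomL u u := wid (map rho u).

Definition htens u v u' v' (f : whomL u v) (g : whomL u' v') :
    whomL (u ++ u') (v ++ v') :=
  wcast (esym (map_catL u u')) (esym (map_catL v v')) (f ⊗ g).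

Definition hbraid u v : whomL (u ++ v) (v ++ u) :=
  wcast (esym (map_catL u v)) (esym (map_catL v u))
    (wbraid (map rho u) (map rho v)).

(** Diagrams are typed by words, and equal tensor products do not determine equal words, so the word
    equalities are recorded too. *)
Definition heq u v u' v' (f : whomL u v) (g : whomL u' v') : Prop :=
  [/\ u = u', v = v' & f ≃ g].

Local Notation "f ≡ g" := (heq f g) (at level 70).
Local Notation "f ⊠ g" := (htens f g) (at level 35, right associativity).
Local Notation "g ∘ f" := (@wcomp C (map rho _) (map rho _) (map rho _) g f).

Lemma heq_refl u v (f : whomL u v) : f ≡ f.
Proof. by split=> //; apply: hsim_refl. Qed.

Lemma heq_sym u v u' v' (f : whomL u v) (g : whomL u' v') : f ≡ g -> g ≡ f.
Proof. by case=> p q fg; split=> //; apply: hsim_sym. Qed.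

Lemma heq_trans u v u' v' u'' v'' (f : whomL u v) (g : whomL u' v')
    (h : whomL u'' v'') : f ≡ g -> g ≡ h -> f ≡ h.
Proof.
case=> p q fg [p' q' gh].
by split; [apply: etrans p p' | apply: etrans q q' | apply: hsim_trans fg gh].
Qed.

Lemma heq_eq u v (f g : whomL u v) : f ≡ g -> f = g.
Proof. by case=> _ _ /hsim_eq. Qed.

Lemma heq_cast u u' v v' (f : whomL u v) :
  u = u' -> v = v' -> exists f' : whomL u' v', f ≡ f'.
Proof. by move=> <- <-; exists f; apply: heq_refl. Qed.

Lemma heq_comp u v w u' v' w' (g : whomL v w) (f : whomL u v)
    (g' : whomL v' w') (f' : whomL u' v') :
  g ≡ g' -> f ≡ f' -> (g ∘ f : whomL u w) ≡ (g' ∘ f' : whomL u' w').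
Proof. by case=> _ p Eg [q _ Ef]; split=> //; apply: hsim_comp. Qed.

Lemma wcast_sim (u u' v v' : seq C) (p : u = u') (q : v = v') (f : whom u v) :
  wcast p q f ≃ f.
Proof. by case: _ / p; case: _ / q; apply: hsim_refl. Qed.

Lemma htens_sim u v u' v' (f : whomL u v) (g : whomL u' v') :
  f ⊠ g ≃ thom f g.
Proof. exact: hsim_trans (wcast_sim _ _ _) (hsim_hcast _ _ _). Qed.

Lemma hbraid_sim u v :
  hbraid u v ≃ braid (tens (map rho u)) (tens (map rho v)).
Proof. exact: hsim_trans (wcast_sim _ _ _) (hsim_hcast _ _ _). Qed.

Lemma heq_tens u v u' v' x y x' y' (f : whomL u v) (g : whomL u' v')
    (f' : whomL x y) (g' : whomL x' y') :
  f ≡ f' -> g ≡ g' -> f ⊠ g ≡ f' ⊠ g'.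
Proof.
case=> p q Ef [p' q' Eg].
split; [by rewrite p p' | by rewrite q q' |].
apply: hsim_trans (htens_sim _ _) _.
exact: hsim_trans (hsim_thom Ef Eg) (hsim_sym (htens_sim _ _)).
Qed.

Lemma htensA u v u' v' u'' v'' (f : whomL u v) (g : whomL u' v')
    (h : whomL u'' v'') : f ⊠ g ⊠ h ≡ (f ⊠ g) ⊠ h.
Proof.
split; [exact: catA | exact: catA |].
apply: hsim_trans (htens_sim _ _) _.
apply: hsim_trans (hsim_thom (hsim_refl _) (htens_sim _ _)) _.
apply: hsim_trans (hsim_thomA _ _ _) _; apply: hsim_sym.
apply: hsim_trans (htens_sim _ _) _.
exact: hsim_thom (htens_sim _ _) (hsim_refl _).
Qed.

Lemma htens_id u v : hid u ⊠ hid v = hid (u ++ v).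
Proof.
apply: hsim_eq; apply: hsim_trans (htens_sim _ _) _.
rewrite thom_id; apply: hsim_id.
by rewrite -tens_cat map_catL.
Qed.

Lemma htens1h u v (f : whomL u v) : hid [::] ⊠ f = f.
Proof.
apply: hsim_eq; apply: hsim_trans (htens_sim _ _) _; exact: hsim_thom1m.
Qed.

Lemma htensh1 u v (f : whomL u v) : f ⊠ hid [::] ≡ f.
Proof.
split; [exact: cats0 | exact: cats0 |].
apply: hsim_trans (htens_sim _ _) _; exact: hsim_thomm1.
Qed.

Lemma htens_comp u v w u' v' w' (g : whomL v w) (f : whomL u v)
    (g' : whomL v' w') (f' : whomL u' v') :
  (g ∘ f : whomL u w) ⊠ (g' ∘ f' : whomL u' w') = (g ⊠ g') ∘ (f ⊠ f').
Proof.
apply: hsim_eq; apply: hsim_trans (htens_sim _ _) _.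
rewrite /wcomp thom_comp; apply: hsim_sym.
exact: hsim_comp (htens_sim _ _) (htens_sim _ _).
Qed.

Lemma hcompA u v w x (h : whomL w x) (g : whomL v w) (f : whomL u v) :
  h ∘ (g ∘ f) = h ∘ g ∘ f.
Proof. exact: Defs.compA. Qed.

Lemma hcomp1h u v (f : whomL u v) : hid v ∘ f = f.
Proof. exact: comp1m. Qed.

Lemma hcomph1 u v (f : whomL u v) : f ∘ hid u = f.
Proof. exact: compm1. Qed.

Lemma hbraid_nat u v u' v' (f : whomL u u') (g : whomL v v') :
  hbraid u' v' ∘ (f ⊠ g) = (g ⊠ f) ∘ hbraid u v.
Proof.
apply: hsim_eq; apply: hsim_trans (hsim_comp (hbraid_sim _ _) (htens_sim _ _)) _.
rewrite braid_nat; apply: hsim_sym.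
exact: hsim_comp (htens_sim _ _) (hbraid_sim _ _).
Qed.

Lemma hbraid0h v : hbraid [::] v ≡ hid v.
Proof.
split; [by [] | exact: cats0 |].
apply: hsim_trans (hbraid_sim _ _) _; exact: braid_unitl.
Qed.

Lemma hbraidh0 u : hbraid u [::] ≡ hid u.
Proof.
split; [exact: cats0 | by [] |].
apply: hsim_trans (hbraid_sim _ _) _; exact: braid_unitr.
Qed.

Lemma hbraid_consr x y v :
  hbraid [:: x] (y :: v) =
  (hid [:: y] ⊠ hbraid [:: x] v) ∘ (hbraid [:: x] [:: y] ⊠ hid v).
Proof.
apply: hsim_eq; apply: hsim_trans (hbraid_sim _ _) _.
have Ev : tens (map rho (y :: v)) = tobj (rho y) (tens (map rho v)).
  exact: (tens_cat [:: rho y]).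
apply: hsim_trans (hsim_braid erefl Ev) _.
pose f := hcast (esym (tobjA (rho x) (rho y) (tens (map rho v))))
  (esym (tobjA (rho y) (rho x) (tens (map rho v))))
  (thom (braid (rho x) (rho y)) (idm (tens (map rho v)))).
apply: hsim_trans (braid_hexr_sim (f := f) (hsim_hcast _ _ _)) _.
apply: hsim_sym; apply: hsim_comp.
  apply: hsim_trans (htens_sim (hid [:: y]) (hbraid [:: x] v)) _.
  exact: hsim_thom (hsim_refl _) (hbraid_sim _ _).
apply: hsim_trans (htens_sim (hbraid [:: x] [:: y]) (hid v)) _.
apply: hsim_trans (hsim_thom (hbraid_sim _ _) (hsim_refl _)) _.
exact: hsim_sym (hsim_hcast _ _ _).
Qed.

Lemma hbraid_consl x u v :
  hbraid (x :: u) v ≡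
  ((hbraid [:: x] v ⊠ hid u) ∘ (hid [:: x] ⊠ hbraid u v)
     : whomL (x :: u ++ v) ((v ++ [:: x]) ++ u)).
Proof.
split=> //; first by rewrite -catA.
apply: hsim_trans (hbraid_sim _ _) _.
have Eu : tens (map rho (x :: u)) = tobj (rho x) (tens (map rho u)).
  exact: (tens_cat [:: rho x]).
apply: hsim_trans (hsim_braid Eu erefl) _.
pose f := hcast (tobjA (rho x) (tens (map rho u)) (tens (map rho v)))
  (tobjA (rho x) (tens (map rho v)) (tens (map rho u)))
  (thom (idm (rho x)) (braid (tens (map rho u)) (tens (map rho v)))).
apply: hsim_trans (braid_hexl_sim (f := f) (hsim_hcast _ _ _)) _.
apply: hsim_sym; apply: hsim_comp.
  apply: hsim_trans (htens_sim (hbraid [:: x] v) (hid u)) _.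
  exact: hsim_thom (hbraid_sim _ _) (hsim_refl _).
apply: hsim_trans (htens_sim (hid [:: x]) (hbraid u v)) _.
apply: hsim_trans (hsim_thom (hsim_refl _) (hbraid_sim _ _)) _.
exact: hsim_sym (hsim_hcast _ _ _).
Qed.

Definition whisker (l : seq L) u v (f : whomL u v) (r : seq L) :
  whomL (l ++ u ++ r) (l ++ v ++ r) := hid l ⊠ f ⊠ hid r.

Lemma whisker_whisker l l' r r' u v (f : whomL u v) :
  whisker l (whisker l' f r') r ≡ whisker (l ++ l') f (r' ++ r).
Proof.
rewrite /whisker; apply: heq_trans (htensA _ _ _) _.
apply: heq_trans (heq_tens (htensA _ _ _) (heq_refl _)) _.
rewrite htens_id -(htens_id r' r).
apply: heq_trans (heq_sym (htensA _ _ _)) _.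
apply: heq_tens; first exact: heq_refl.
exact: heq_sym (htensA _ _ _).
Qed.

Lemma whisker_comp l r u v w (g : whomL v w) (f : whomL u v) :
  whisker l (g ∘ f : whomL u w) r = whisker l g r ∘ whisker l f r.
Proof. by rewrite /whisker -!htens_comp !hcomp1h. Qed.

Lemma whisker_id l r u : whisker l (hid u) r = hid (l ++ u ++ r).
Proof. by rewrite /whisker !htens_id. Qed.

Lemma heq_whisker l r u v u' v' (f : whomL u v) (g : whomL u' v') :
  f ≡ g -> whisker l f r ≡ whisker l g r.
Proof.
by move=> fg; apply/heq_tens/heq_tens => //; apply: heq_refl.
Qed.

Lemma whisker0 u v (f : whomL u v) : whisker [::] f [::] ≡ f.
Proof. by rewrite /whisker htens1h; apply: htensh1. Qed.

(** The interchange law. [g1] and [g2] are whiskerings of [g] rebracketed so that they compose with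
    those of [f]. *)
Lemma whiskerC l s r x x' y y' (f : whomL x x') (g : whomL y y')
    (g1 : whomL (l ++ x ++ s ++ y ++ r) (l ++ x ++ s ++ y' ++ r))
    (g2 : whomL (l ++ x' ++ s ++ y ++ r) (l ++ x' ++ s ++ y' ++ r)) :
  g1 ≡ whisker (l ++ x ++ s) g r -> g2 ≡ whisker (l ++ x' ++ s) g r ->
  whisker l f (s ++ y' ++ r) ∘ g1 = g2 ∘ whisker l f (s ++ y ++ r).
Proof.
have E z : whisker (l ++ z ++ s) g r ≡ hid l ⊠ hid z ⊠ whisker s g r.
  rewrite /whisker -!htens_id; apply: heq_trans (heq_sym (htensA _ _ _)) _.
  apply: heq_tens; first exact: heq_refl.
  exact: heq_sym (htensA _ _ _).
move=> /heq_trans/(_ (E x))/heq_eq-> /heq_trans/(_ (E x'))/heq_eq->.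
rewrite /whisker -!htens_comp !hcomp1h !hcomph1.
by congr (_ ⊠ _ ⊠ _); rewrite htens_id hcomp1h htens_id hcomph1.
Qed.

Lemma whisker_assoc l m s r u v (f : whomL u v) :
  exists f' : whomL (l ++ m ++ s ++ u ++ r) (l ++ m ++ s ++ v ++ r),
    f' ≡ whisker (l ++ m ++ s) f r.
Proof.
have [] := @heq_cast _ (l ++ m ++ s ++ u ++ r) _ (l ++ m ++ s ++ v ++ r)
  (whisker (l ++ m ++ s) f r); rewrite -?catA // => f' Ef'.
by exists f'; apply: heq_sym.
Qed.

End LabelledWords.

(** * String diagrams and their rewriting *)

Section Diagrams.
Variables (C : strict_braided) (L op : eqType) (rho : L -> C).
Variables (odom ocod : op -> seq L).
Variable osem : forall o, whomL rho (odom o) (ocod o).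
Implicit Types u v w : seq L.

Definition cell : eqType := (op + L * L)%type.

Definition cdom (g : cell) :=
  match g with inl o => odom o | inr (x, y) => [:: x; y] end.

Definition ccod (g : cell) :=
  match g with inl o => ocod o | inr (x, y) => [:: y; x] end.

Definition csem (g : cell) : whomL rho (cdom g) (ccod g) :=
  match g with inl o => osem o | inr (x, y) => hbraid rho [:: x] [:: y] end.

(* A cell together with the number of strands to its left; a diagram lists its
   layers from the source to the target. *)
Definition layer : eqType := (nat * cell)%type.
Notation diagram := (seq layer).
Implicit Types (d p q : diagram) (a b h : layer).

Local Notation "f ≡ g" := (heq f g) (at level 70).
Local Notation "g ∘ f" := (@wcomp C (map rho _) (map rho _) (map rho _) g f).

(** A relation rather than an evaluator: a list of layers need not be composable, and asserting the
    splitting [l], [r] avoids computing with transports. *)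
Fixpoint den u d v : whomL rho u v -> Prop :=
  match d with
  | [::] => fun f => f ≡ hid rho u
  | (k, g) :: d' => fun f =>
      exists l r (f' : whomL rho (l ++ ccod g ++ r) v),
        [/\ u = l ++ cdom g ++ r, size l = k, den d' f'
          & f ≡ (f' ∘ whisker l (csem g) r : whomL rho (l ++ cdom g ++ r) v)]
  end.
Arguments den u d v f : clear implicits.

Lemma den_heq u d v u' v' (f : whomL rho u v) (f' : whomL rho u' v') :
  f ≡ f' -> den u d v f -> den u' d v' f'.
Proof.
move=> E; case: (E) => p q _; subst u' v'; by rewrite (heq_eq E).
Qed.

Lemma den_cat u v w d d' (f : whomL rho u v) (g : whomL rho v w) :
  den u d v f -> den v d' w g -> den u (d ++ d') w (g ∘ f).
Proof.
elim: d u f => [|[k c] d IHd] u f /=.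
  move=> E dg; case: (E) => _ p _; subst v.
  by rewrite (heq_eq E) hcomph1.
move=> [l [r [f' [eu lk df' E]]]] dg; subst u; exists l, r, (g ∘ f'); split=> //.
  exact: IHd.
by rewrite (heq_eq E) hcompA; apply: heq_refl.
Qed.

Lemma den_catP u w d d' (f : whomL rho u w) :
  den u (d ++ d') w f -> exists v (f1 : whomL rho u v) (f2 : whomL rho v w),
    [/\ den u d v f1, den v d' w f2 & f = f2 ∘ f1].
Proof.
elim: d u f => [|[k c] d IHd] u f /=.
  move=> df; exists u, (hid rho u), f; split=> //; first exact: heq_refl.
  by rewrite hcomph1.
case=> [l [r [f' [eu lk /IHd [v [f1 [f2 [df1 df2 Ef']]]] E]]]].
subst u f'; exists v, (f1 ∘ whisker l (csem c) r), f2; split=> //.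
  by exists l, r, f1; split=> //; apply: heq_refl.
by rewrite (heq_eq E) hcompA.
Qed.

Lemma eq_cat_size (l l' r r' : seq L) :
  size l = size l' -> l ++ r = l' ++ r' -> l = l' /\ r = r'.
Proof. by move=> E /eqP; rewrite eqseq_cat // => /andP[/eqP-> /eqP->]. Qed.

(** The offset fixes the length of [l], so the word splits in only one way at each layer. *)
Lemma den_det u d v v' (f : whomL rho u v) (f' : whomL rho u v') :
  den u d v f -> den u d v' f' -> f ≡ f'.
Proof.
elim: d u f f' => [|[k c] d IHd] u f f' /=.
  by move=> E E'; apply: heq_trans E (heq_sym E').
move=> [l [r [g [eu lk dg E]]]] [l' [r' [g' [e lk' dg' E']]]]; subst u.
have [el /(eq_cat_size erefl)[_ er]] := eq_cat_size (etrans lk (esym lk')) e.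
subst l' r'.
apply: heq_trans E _; apply: heq_sym; apply: heq_trans E' _.
by apply: heq_comp (heq_refl _); apply: heq_sym; apply: IHd.
Qed.

Definition shift n d : diagram := [seq (n + h.1, h.2) | h <- d].

Lemma den_shift l r u d v (f : whomL rho u v) :
  den u d v f ->
  den (l ++ u ++ r) (shift (size l) d) (l ++ v ++ r) (whisker l f r).
Proof.
elim: d u f => [|[k c] d IHd] u f /=.
  by move=> /(heq_whisker l r); rewrite whisker_id.
case=> [l' [r' [f' [eu <- df' E]]]]; subst u.
have e : l ++ (l' ++ ccod c ++ r') ++ r = (l ++ l') ++ ccod c ++ (r' ++ r).
  by rewrite -!catA.
have [f'' Ef''] := heq_cast (whisker l f' r) e erefl.
exists (l ++ l'), (r' ++ r), f''; split.
- by rewrite -!catA.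
- by rewrite size_cat.
- exact: den_heq Ef'' (IHd _ _ df').
rewrite (heq_eq E) whisker_comp; apply: heq_comp; first exact: Ef''.
exact: whisker_whisker.
Qed.

(** Offsets of [b] count strands after [a] has acted. The layer on the right has its offset
    corrected by the change in strand count made by the layer on the left. *)
Definition swap a b : option (layer * layer) :=
  if b.1 + size (cdom b.2) <= a.1 then
    Some (b, (a.1 - size (cdom b.2) + size (ccod b.2), a.2))
  else if a.1 + size (ccod a.2) <= b.1 then
    Some ((b.1 - size (ccod a.2) + size (cdom a.2), b.2), a)
  else None.

Lemma eq_cat_prefix (l m r l' r' : seq L) :
  l ++ m ++ r = l' ++ r' -> size l + size m <= size l' ->
  exists s, l' = l ++ m ++ s /\ r = s ++ r'.
Proof.
move=> e le_lm; have: size (l ++ m) <= size l' by rewrite size_cat.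
exists (drop (size (l ++ m)) l').
have e' : take (size (l ++ m)) (l' ++ r') = l ++ m.
  by rewrite -e catA take_size_cat.
have El : l' = (l ++ m) ++ drop (size (l ++ m)) l'.
  by rewrite -{1}e' takel_cat // cat_take_drop.
split; first by rewrite catA.
by move: e; rewrite {1}El catA -(catA (l ++ m)) => /(eq_cat_size erefl)[].
Qed.

(** One direction suffices: a normal form must still denote the initial morphism. *)
Definition refines d d' : Prop :=
  forall u v (f : whomL rho u v), den u d v f -> den u d' v f.

Lemma refines_refl d : refines d d. Proof. by []. Qed.

Lemma refines_trans d2 d1 d3 : refines d1 d2 -> refines d2 d3 -> refines d1 d3.
Proof. by move=> r12 r23 u v f /r12/r23. Qed.

Lemma refines_cat d1 d1' d2 d2' :
  refines d1 d1' -> refines d2 d2' -> refines (d1 ++ d2) (d1' ++ d2').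
Proof.
move=> r1 r2 u v f /den_catP[w [f1 [f2 [/r1 df1 /r2 df2 ->]]]].
exact: den_cat df1 df2.
Qed.

Lemma refines_catl d d1 d2 : refines d1 d2 -> refines (d ++ d1) (d ++ d2).
Proof. exact/refines_cat/refines_refl. Qed.

Lemma refines_catr d d1 d2 : refines d1 d2 -> refines (d1 ++ d) (d2 ++ d).
Proof. by move=> r12; apply/refines_cat/refines_refl. Qed.

Arguments refines_trans {d2 d1 d3} _ _.
Arguments refines_cat {d1 d1' d2 d2'} _ _.
Arguments refines_catl d {d1 d2} _.
Arguments refines_catr d {d1 d2} _.

Lemma swap_refines a b a' b' :
  swap a b = Some (b', a') -> refines [:: a; b] [:: b'; a'].
Proof.
case: a b => [ka a] [kb b]; rewrite /swap /=.
case: ifP => [le_ba [<- <-] | _].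
  move=> u v f [l1 [r1 [f1 [eu el1 [l2 [r2 [f2 [e el2 df2 Ef1]]]] Ef]]]].
  have [|s [es es']] := eq_cat_prefix (esym e); first by rewrite el1 el2.
  subst u l1 r2.
  have [g1 Eg1] := whisker_assoc l2 (cdom b) s r1 (csem a).
  have [g2 Eg2] := whisker_assoc l2 (ccod b) s r1 (csem a).
  have e2 : l2 ++ ccod b ++ s ++ ccod a ++ r1 =
            (l2 ++ ccod b ++ s) ++ ccod a ++ r1 by rewrite -!catA.
  have [f3 Ef3] := heq_cast f2 e2 erefl.
  exists l2, (s ++ cdom a ++ r1), (f2 ∘ g2); split=> //.
  - by rewrite -!catA.
  - exists (l2 ++ ccod b ++ s), r1, f3; split.
    + by rewrite -!catA.
    + rewrite -el1 !size_cat (addnCA _ (size (cdom b))) addKn.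
      by rewrite (addnC (size (ccod b))) addnA.
    + exact: (den_heq (d := [::]) Ef3 df2).
    + exact: heq_comp Ef3 Eg2.
  rewrite -hcompA -(whiskerC (csem b) Eg1 Eg2) hcompA.
  apply: heq_trans Ef _; apply: heq_comp => //; exact: heq_sym.
case: ifP => [le_ab [<- <-] | //].
move=> u v f [l1 [r1 [f1 [eu el1 [l2 [r2 [f2 [e el2 df2 Ef1]]]] Ef]]]].
have [|s [es es']] := eq_cat_prefix e; first by rewrite el1 el2.
subst u l2 r1.
have [g1 Eg1] := whisker_assoc l1 (cdom a) s r2 (csem b).
have [g2 Eg2] := whisker_assoc l1 (ccod a) s r2 (csem b).
have e2 : (l1 ++ ccod a ++ s) ++ ccod b ++ r2 =
          l1 ++ ccod a ++ s ++ ccod b ++ r2 by rewrite -!catA.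
have [f3 Ef3] := heq_cast f2 e2 erefl.
have e3 : l1 ++ cdom a ++ s ++ ccod b ++ r2 =
          (l1 ++ cdom a ++ s) ++ ccod b ++ r2 by rewrite -!catA.
have [f4 Ef4] :=
  heq_cast (f3 ∘ whisker l1 (csem a) (s ++ ccod b ++ r2)) e3 erefl.
exists (l1 ++ cdom a ++ s), r2, f4; split.
- by rewrite -!catA.
- rewrite -el2 !size_cat (addnCA _ (size (ccod a))) addKn.
  by rewrite (addnC (size (cdom a))) addnA.
- exists l1, (s ++ ccod b ++ r2), f3; split=> //.
  + exact: (den_heq (d := [::]) Ef3 df2).
  + exact: heq_sym.
apply: heq_trans Ef _.
have Ef1' : f1 ≡ f3 ∘ g2.
  by apply: heq_trans Ef1 _; apply: heq_comp Ef3 (heq_sym Eg2).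
rewrite (heq_eq Ef1') -hcompA -(whiskerC (csem a) Eg1 Eg2) hcompA.
exact: heq_comp Ef4 Eg1.
Qed.

(** * Matching and rewriting of redexes *)

Fixpoint pull d h : option (layer * diagram) :=
  if d is a :: d' then
    if pull d' h is Some (h1, d1) then
      if swap a h1 is Some (h2, a') then Some (h2, a' :: d1) else None
    else None
  else Some (h, [::]).

Lemma pull_refines d h h' d' :
  pull d h = Some (h', d') -> refines (rcons d h) (h' :: d').
Proof.
elim: d h' d' => [|a d IHd] h' d' /=; first by case=> <- <-.
case: pull IHd => [[h1 d1]|] // /(_ _ _ erefl) IHd.
case E: swap => [[h2 a']|] // [<- <-].
apply: refines_trans (refines_catl [:: a] IHd) _.
exact: (refines_catr d1 (swap_refines E)).
Qed.

(** The translation carrying the pattern onto the block. If the subtraction truncates to 0, the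
    comparison with the shifted pattern fails. *)
Definition rel_offset p d := head 0 (unzip1 d) - head 0 (unzip1 p).

(* Brings the layers of the connected pattern [p] next to each other: [blk] is
   the part already found, [skip] the layers that must stay after it, and every
   other layer is moved before it. *)
Fixpoint gather p pre blk skip d : option (diagram * diagram * diagram) :=
  if size blk == size p then Some (pre, blk, skip ++ d) else
  if d is h :: d' then
    if pull skip h is Some (h1, skip1) then
      if [:: h1] == shift (rel_offset p blk) (take 1 (drop (size blk) p)) then
        gather p pre (rcons blk h1) skip1 d'
      else if pull blk h1 is Some (h2, blk2) then
        gather p (rcons pre h2) blk2 skip1 d'
      else gather p pre blk (rcons skip h) d'
    else gather p pre blk (rcons skip h) d'
  else None.

Lemma gather_refines p pre blk skip d pre' blk' post :
  gather p pre blk skip d = Some (pre', blk', post) ->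
  refines (pre ++ blk ++ skip ++ d) (pre' ++ blk' ++ post).
Proof.
elim: d pre blk skip => [|h d IHd] pre blk skip /=; case: eqP => // _.
- by case=> <- <- <-; apply: refines_refl.
- by case=> <- <- <-; apply: refines_refl.
have later : gather p pre blk (rcons skip h) d = Some (pre', blk', post) ->
    refines (pre ++ blk ++ skip ++ h :: d) (pre' ++ blk' ++ post).
  by move/IHd; rewrite cat_rcons.
case E: pull => [[h1 skip1]|] //.
have r1 : refines (pre ++ blk ++ skip ++ h :: d)
    (pre ++ blk ++ h1 :: skip1 ++ d).
  do 2!apply: refines_catl; rewrite -cat_rcons -cat_cons.
  exact/refines_catr/pull_refines.
case: eqP => _.
  by move/IHd; rewrite cat_rcons; apply: refines_trans.
case E2: pull => [[h2 blk2]|] // /IHd r2.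
apply: refines_trans r1 (refines_trans _ r2).
rewrite cat_rcons; apply: refines_catl; rewrite -cat_rcons -cat_cons.
exact/refines_catr/pull_refines.
Qed.

Fixpoint target w d :=
  if d is (k, g) :: d' then
    target (take k w ++ ccod g ++ drop (k + size (cdom g)) w) d'
  else w.

Lemma den_target u d v (f : whomL rho u v) : den u d v f -> target u d = v.
Proof.
elim: d u f => [|[k g] d IHd] u f /=; first by case.
case=> [l [r [f' [eu lk /IHd df' _]]]]; rewrite -{}df' {}eu -{}lk.
by rewrite take_size_cat // addnC -drop_drop drop_size_cat // drop_size_cat.
Qed.

Definition rule : Type := (seq L * diagram * diagram)%type.

(** Asking for a common value also makes both sides composable from the source word, so a rewritten
    diagram still denotes. *)
Definition sound (r : rule) : Prop :=
  exists v (f : whomL rho r.1.1 v), den _ r.1.2 v f /\ den _ r.2 v f.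

(** Layers moved before the block can change its offsets, so the whole pattern is compared again.
    The source word is tested because untouched strands leave no trace in the layers. *)
Definition try_rule w (r : rule) pre h d : option diagram :=
  let: (u, p, q) := r in
  if [:: h] != shift (rel_offset p [:: h]) (take 1 p) then None else
  if gather p pre [:: h] [::] d is Some (pre', blk', post) then
    let k := rel_offset p blk' in
    let x := target w pre' in
    if [&& blk' == shift k p, k <= size x
         & x == take k x ++ u ++ drop (k + size u) x]
    then Some (pre' ++ shift k q ++ post) else None
  else None.

Lemma try_rule_den w r pre h d d' v (f : whomL rho w v) :
  sound r -> try_rule w r pre h d = Some d' ->
  den w (pre ++ h :: d) v f -> den w d' v f.
Proof.
case: r => [[u p] q] /= [u' [g [/= dp dq]]]; case: ifP => // _.
case E: gather => [[[pre' blk'] post]|] //.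
move: (rel_offset _ _) => k.
case: ifP => // /and3P[/eqP Eblk le_kx /eqP Ex] [<-].
move=> /(gather_refines E); rewrite Eblk.
case/den_catP=> [x [f1 [f2 [df1 df2 ->]]]]; apply: (den_cat df1).
case/den_catP: df2 => [y [g1 [g2 [dg1 dg2 ->]]]]; apply: (den_cat _ dg2).
rewrite (den_target df1) in le_kx Ex.
move: (take k x) (drop _ x) (size_takel le_kx) Ex => l r lk Ex; subst x k.
have g1h := den_det dg1 (den_shift l r dp).
by apply: den_heq (heq_sym g1h) _; apply: den_shift.
Qed.

Fixpoint rewrite_at w r pre d : option diagram :=
  if d is h :: d' then
    if try_rule w r pre h d' is Some d1 then Some d1
    else rewrite_at w r (rcons pre h) d'
  else None.

Lemma rewrite_at_den w r pre d d' v (f : whomL rho w v) :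
  sound r -> rewrite_at w r pre d = Some d' ->
  den w (pre ++ d) v f -> den w d' v f.
Proof.
move=> sr; elim: d pre => // h d IHd pre /=.
case E: try_rule => [d1|]; first by case=> <-; apply: try_rule_den E.
by move/IHd; rewrite cat_rcons.
Qed.

Fixpoint exhaust w r n d : diagram :=
  if n is n'.+1 then
    if rewrite_at w r [::] d is Some d' then exhaust w r n' d' else d
  else d.

Fixpoint normalize w (rs : seq rule) n d : diagram :=
  if n is n'.+1 then
    let d' := foldl (fun d r => exhaust w r 100 d) d rs in
    if d' == d then d else normalize w rs n' d'
  else d.

Fixpoint all_sound (rs : seq rule) : Prop :=
  if rs is r :: rs' then sound r /\ all_sound rs' else True.

Lemma all_sound_cat rs rs' :
  all_sound rs -> all_sound rs' -> all_sound (rs ++ rs').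
Proof. by move=> + ?; elim: rs => //= r rs IHrs [? /IHrs]. Qed.

Lemma exhaust_den w r n d v (f : whomL rho w v) :
  sound r -> den w d v f -> den w (exhaust w r n d) v f.
Proof.
move=> sr; elim: n d => //= n IHn d df.
case E: rewrite_at => [d'|] //; apply: IHn; exact: rewrite_at_den E df.
Qed.

Lemma normalize_den w rs n d v (f : whomL rho w v) :
  all_sound rs -> den w d v f -> den w (normalize w rs n d) v f.
Proof.
move=> srs; elim: n d => // n IHn d df; rewrite [normalize _ _ _ _]/=.
case: eqP => // _; apply: IHn.
elim: rs srs d df => // r rs IHrs [sr srs] d df.
exact: IHrs srs _ (exhaust_den 100 sr df).
Qed.

(* Two planar diagrams differing by the interchange law get the same normal
   form: the leftmost layer available is always taken first. *)
Fixpoint insert_layer h d : diagram :=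
  if d is b :: d' then
    if b.1 + size (cdom b.2) <= h.1 then
      if swap h b is Some (b', h') then b' :: insert_layer h' d' else h :: d
    else h :: d
  else [:: h].

Lemma insert_layer_refines h d : refines (h :: d) (insert_layer h d).
Proof.
elim: d h => [|b d IHd] h /=; first exact: refines_refl.
case: ifP => _; last exact: refines_refl.
case E: swap => [[b' h']|]; last exact: refines_refl.
apply: refines_trans (refines_catr d (swap_refines E)) _.
exact: (refines_catl [:: b'] (IHd h')).
Qed.

Definition planar d : diagram :=
  iter (size d) (foldr insert_layer [::]) d.

Lemma planar_refines d : refines d (planar d).
Proof.
rewrite /planar; elim: (size d) => [|n IHn] //=.
apply: refines_trans IHn _; elim: (iter n _ d) => //= h d' IHd'.
apply: refines_trans (refines_catl [:: h] IHd') _.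
exact: insert_layer_refines.
Qed.

(** * Typed terms and their diagrams *)

Inductive term : seq L -> seq L -> Type :=
| Tid u : term u u
| Tcell g : term (cdom g) (ccod g)
| Tcomp u v w : term v w -> term u v -> term u w
| Ttens u v u' v' : term u v -> term u' v' -> term (u ++ u') (v ++ v')
| Tbraid u v : term (u ++ v) (v ++ u).

(** On closed words this computes back to the original formula, so a proof of an axiom is, by
    conversion, a proof about its reification. *)
Fixpoint interp u v (t : term u v) : whomL rho u v :=
  match t in term u v return whomL rho u v with
  | Tid u => hid rho u
  | Tcell g => csem g
  | Tcomp _ _ _ s t => interp s ∘ interp t
  | Ttens _ _ _ _ s t => htens (interp s) (interp t)
  | Tbraid u v => hbraid rho u v
  end.

(** The decomposition of a block braiding into elementary crossings given by the hexagons. *)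
Fixpoint cross1 x v : diagram :=
  if v is y :: v' then (0, inr (x, y)) :: shift 1 (cross1 x v') else [::].

Fixpoint cross u v : diagram :=
  if u is x :: u' then shift 1 (cross u' v) ++ cross1 x v else [::].

Fixpoint layers u v (t : term u v) : diagram :=
  match t with
  | Tid _ => [::]
  | Tcell g => [:: (0, g)]
  | Tcomp _ _ _ s t => layers t ++ layers s
  | Ttens _ v _ _ s t => layers s ++ shift (size v) (layers t)
  | Tbraid u v => cross u v
  end.

Lemma den_tensl l u d v (f : whomL rho u v) :
  den u d v f -> den (l ++ u) (shift (size l) d) (l ++ v) (htens (hid rho l) f).
Proof.
move=> /(den_shift l [::]); apply: den_heq.
apply: heq_tens (htensh1 _).
exact: heq_refl.
Qed.

Lemma den_tensr r u d v (f : whomL rho u v) :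
  den u d v f -> den (u ++ r) d (v ++ r) (htens f (hid rho r)).
Proof.
move=> /(den_shift [::] r); rewrite /whisker htens1h.
by rewrite /shift (eq_map (g := id)) ?map_id // => -[].
Qed.

Lemma den_cross1 x v :
  den (x :: v) (cross1 x v) (v ++ [:: x]) (hbraid rho [:: x] v).
Proof.
elim: v => [|y v IHv] /=; first exact: (hbraidh0 rho [:: x]).
exists [::], v, (htens (hid rho [:: y]) (hbraid rho [:: x] v)); split=> //.
  exact: (den_tensl [:: y] IHv).
by rewrite hbraid_consr /whisker htens1h; apply: heq_refl.
Qed.

Lemma den_cross u v : den (u ++ v) (cross u v) (v ++ u) (hbraid rho u v).
Proof.
elim: u => [|x u IHu] /=; first exact: (hbraid0h rho v).
apply: den_heq (heq_sym (hbraid_consl rho x u v)) _.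
apply: den_cat (den_tensl [:: x] IHu) _.
exact: (den_tensr u (den_cross1 x v)).
Qed.

Lemma den_layers u v (t : term u v) : den u (layers t) v (interp t).
Proof.
elim: t => {u v} [u | g | u v w s IHs t IHt | u v u' v' s IHs t IHt | u v] /=.
- exact: heq_refl.
- apply: (den_heq (d := [:: (0, g)]) (whisker0 (csem g))).
  exists [::], [::], (hid rho _); split=> //; first exact: heq_refl.
  by rewrite hcomp1h; apply: heq_refl.
- exact: den_cat IHt IHs.
- have -> : htens (interp s) (interp t) =
      htens (hid rho v) (interp t) ∘ htens (interp s) (hid rho u').
    by rewrite -htens_comp hcomp1h hcomph1.
  exact: den_cat (den_tensr u' IHs) (den_tensl v IHt).
- exact: den_cross.
Qed.

Definition term_rule u v (s t : term u v) : rule := (u, layers s, layers t).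

Lemma term_rule_sound u v (s t : term u v) :
  interp s = interp t -> sound (term_rule s t).
Proof.
move=> Est; exists v, (interp s); split; first exact: den_layers.
by rewrite Est; apply: den_layers.
Qed.

(* [early] moves the cell [g] before the crossings. *)
Definition slide_left (early : bool) (g : cell) (x : L) : rule :=
  let s := Tcomp (Tbraid (ccod g) [:: x]) (Ttens (Tcell g) (Tid [:: x])) in
  let t := Tcomp (Ttens (Tid [:: x]) (Tcell g)) (Tbraid (cdom g) [:: x]) in
  if early then term_rule t s else term_rule s t.

Definition slide_right (early : bool) (g : cell) (x : L) : rule :=
  let s := Tcomp (Tbraid [:: x] (ccod g)) (Ttens (Tid [:: x]) (Tcell g)) in
  let t := Tcomp (Ttens (Tcell g) (Tid [:: x])) (Tbraid [:: x] (cdom g)) in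
  if early then term_rule t s else term_rule s t.

Lemma slide_left_sound early g x : sound (slide_left early g x).
Proof.
have E := hbraid_nat (csem g) (hid rho [:: x]).
by case: early; apply: term_rule_sound; [exact: esym | ].
Qed.

Lemma slide_right_sound early g x : sound (slide_right early g x).
Proof.
have E := hbraid_nat (hid rho [:: x]) (csem g).
by case: early; apply: term_rule_sound; [exact: esym | ].
Qed.

(* The bounds [100] in [normalize] only guard against non-termination. *)
Definition normal_form u v (stages : seq (seq rule)) (t : term u v) : diagram :=
  planar (foldl (fun d rs => normalize u rs 100 d) (layers t) stages).

Fixpoint stages_sound (stages : seq (seq rule)) : Prop :=
  if stages is rs :: stages' then all_sound rs /\ stages_sound stages'
  else True.

Lemma normal_form_den u v stages (t : term u v) :
  stages_sound stages -> den u (normal_form stages t) v (interp t).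
Proof.
move=> st; apply: planar_refines.
elim: stages (layers t) (den_layers t) st => // rs stages IH d dt [srs st].
exact: IH (normalize_den 100 srs dt) st.
Qed.

(** Each normal form denotes the morphism it came from, and a diagram has at most one value.
    Confluence is not claimed, and the two sides may use different stages. *)
Theorem normal_form_eq u v (s t : term u v) stages stages' :
  stages_sound stages -> stages_sound stages' ->
  normal_form stages s = normal_form stages' t -> interp s = interp t.
Proof.
move=> ss st Est; apply: heq_eq.
by apply: den_det (normal_form_den s ss) _; rewrite Est; apply: normal_form_den.
Qed.

End Diagrams.

(** * Hopf data *)

(* [false] and [true] label the strands [B1] and [B2]; [Phi2 false] is [phi12]
   and [Phi2 true] is [phi21]. *)
Inductive hopf_op : Set :=
| Mul of bool | Comul of bool | Act of bool | Coact of bool | Phi2 of bool.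

Definition hopf_op_code (o : hopf_op) : nat * bool :=
  match o with
  | Mul b => (0, b) | Comul b => (1, b) | Act b => (2, b)
  | Coact b => (3, b) | Phi2 b => (4, b)
  end.

Definition hopf_op_decode (c : nat * bool) : hopf_op :=
  match c with
  | (0, b) => Mul b | (1, b) => Comul b | (2, b) => Act b
  | (3, b) => Coact b | (_, b) => Phi2 b
  end.

Lemma hopf_op_codeK : cancel hopf_op_code hopf_op_decode.
Proof. by case. Qed.

HB.instance Definition _ := Equality.copy hopf_op (can_type hopf_op_codeK).

Definition hopf_op_dom (o : hopf_op) : seq bool :=
  match o with
  | Mul b => [:: b; b] | Comul b => [:: b] | Act _ => [:: true; false]
  | Coact b => [:: b] | Phi2 b => [:: b; ~~ b]
  end.

Definition hopf_op_cod (o : hopf_op) : seq bool :=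
  match o with
  | Mul b => [:: b] | Comul b => [:: b; b] | Act b => [:: b]
  | Coact _ => [:: true; false] | Phi2 b => [:: ~~ b; b]
  end.

Definition hopf_cell : eqType := cell bool hopf_op.

Definition op_cell (o : hopf_op) : hopf_cell := inl o.

(* Crossings are moved after the cells that split strands and before those that
   merge strands, so that they do not separate the two cells of a redex. The
   choice for [phi12] and [phi21] is dictated by their neighbours in
   [DeltaB] and [mB]. *)
Definition splitting : seq hopf_cell :=
  map op_cell
    [:: Comul false; Comul true; Coact false; Coact true; Phi2 false].

Definition merging : seq hopf_cell :=
  map op_cell [:: Mul false; Mul true; Act false; Act true; Phi2 true].

Definition crossings : seq hopf_cell :=
  [:: inr (false, false); inr (false, true);
      inr (true, false); inr (true, true)].

(** Crossings slide on one side only: this orients the Yang-Baxter relation, and sliding them on the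
    other side would undo it. *)
Definition slides : seq (rule bool hopf_op) :=
  let letters := [:: false; true] in
  let slideL := slide_left hopf_op_dom hopf_op_cod in
  let slideR := slide_right hopf_op_dom hopf_op_cod in
  [seq slideL true g x | g <- splitting, x <- letters]
  ++ [seq slideR true g x | g <- splitting, x <- letters]
  ++ [seq slideL false g x | g <- merging ++ crossings, x <- letters]
  ++ [seq slideR false g x | g <- merging, x <- letters].

Section HopfDatum.
Variables (C : strict_braided) (B1 B2 : C) (D : hopf_data B1 B2).
Hypothesis hD : is_hopf_datum D.

Local Notation id1 := (wid [:: B1]).
Local Notation id2 := (wid [:: B2]).
Local Notation Ψ12 := (wbraid [:: B1] [:: B2]).
Local Notation Ψ21 := (wbraid [:: B2] [:: B1]).
Local Notation m1 := (Defs.mul (alg1 D)).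
Local Notation m2 := (Defs.mul (alg2 D)).
Local Notation Δ1 := (comul (coalg1 D)).
Local Notation Δ2 := (comul (coalg2 D)).
Local Notation μl := (mu_l D).
Local Notation νl := (nu_l D).
Local Notation μr := (mu_r D).
Local Notation νr := (nu_r D).

Definition strand (b : bool) : C := if b then B2 else B1.

Definition hopf_op_sem (o : hopf_op) :
    whomL strand (hopf_op_dom o) (hopf_op_cod o) :=
  match o with
  | Mul false => m1 | Mul true => m2
  | Comul false => Δ1 | Comul true => Δ2
  | Act false => μl | Act true => μr
  | Coact false => νl | Coact true => νr
  | Phi2 false => phi12 D | Phi2 true => phi21 D
  end.

Lemma slides_sound : all_sound hopf_op_sem slides.
Proof.
rewrite /slides; do ![apply: all_sound_cat].
all: do ?[split; first by [apply: slide_left_sound | apply: slide_right_sound]].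
all: exact I.
Qed.

(** * Reification of formulas and choice of rules *)

Ltac reify_word w :=
  lazymatch w with
  | [::] => constr:(@nil bool)
  | B1 :: ?w' => let u := reify_word w' in constr:(false :: u)
  | B2 :: ?w' => let u := reify_word w' in constr:(true :: u)
  end.

Ltac reify f :=
  let op o := constr:(Tcell hopf_op_dom hopf_op_cod (op_cell o)) in
  lazymatch f with
  | wcomp ?g ?h =>
      let s := reify g in let t := reify h in constr:(Tcomp s t)
  | wtens ?g ?h =>
      let s := reify g in let t := reify h in constr:(Ttens s t)
  | wid ?w =>
      let u := reify_word w in constr:(Tid hopf_op_dom hopf_op_cod u)
  | wbraid ?v ?w =>
      let u := reify_word v in let u' := reify_word w in
      constr:(Tbraid hopf_op_dom hopf_op_cod u u')
  | m1 => op (Mul false) | m2 => op (Mul true)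
  | Δ1 => op (Comul false) | Δ2 => op (Comul true)
  | μl => op (Act false) | μr => op (Act true)
  | νl => op (Coact false) | νr => op (Coact true)
  | phi12 D => op (Phi2 false) | phi21 D => op (Phi2 true)
  end.

(** As rewriting rules, these bracket products and coproducts to the left and turn the action of a
    product into iterated actions, dually for coactions. *)
Definition structural :=
  (tt, esym (mul_assoc (alg1 D)), esym (mul_assoc (alg2 D)),
   esym (comul_assoc (coalg1 D)), esym (comul_assoc (coalg2 D)),
   (mu_l_module hD).1, (mu_r_module hD).1,
   (nu_l_comodule hD).1, (nu_r_comodule hD).1).

(** Stated so that unfolding becomes a rule that each stage may use or withhold. *)
Definition phi12_unfold :
  phi12 D = (m2 ⊗ m1) ∘ (id2 ⊗ Ψ12 ⊗ id1) ∘ (νl ⊗ νr) := erefl.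

Definition phi21_unfold :
  phi21 D = (μl ⊗ μr) ∘ (id2 ⊗ Ψ21 ⊗ id1) ∘ (Δ2 ⊗ Δ1) := erefl.

(** The initial [tt] contributes the slides; the rule listed last is exhausted first. *)
Ltac reify_rules hs :=
  lazymatch hs with
  | tt => constr:(existT (all_sound hopf_op_sem) slides slides_sound)
  | structural =>
      let hs' := eval cbv delta [structural] in structural in reify_rules hs'
  | (?hs', ?h) =>
      let rs := reify_rules hs' in
      lazymatch rs with existT _ ?l ?pl =>
      lazymatch type of h with ?a = ?b =>
        let s := reify a in let t := reify b in
        constr:(existT (all_sound hopf_op_sem) (term_rule s t :: l)
          (conj (@term_rule_sound _ _ _ _ _ _ hopf_op_sem _ _ s t h) pl))
      end end
  end.

Ltac reify_stages ss :=
  lazymatch ss with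
  | tt => constr:(existT (stages_sound hopf_op_sem) [::] I)
  | (?hs, ?ss') =>
      let rs := reify_rules hs in let st := reify_stages ss' in
      lazymatch rs with existT _ ?l ?pl =>
      lazymatch st with existT _ ?k ?pk =>
        constr:(existT (stages_sound hopf_op_sem) (l :: k) (conj pl pk))
      end end
  end.

Ltac diagram lhs_stages rhs_stages :=
  lazymatch goal with |- ?a = ?b =>
    let s := reify a in let t := reify b in
    let ls := reify_stages lhs_stages in let rs := reify_stages rhs_stages in
    lazymatch ls with existT _ ?l ?pl =>
    lazymatch rs with existT _ ?r ?pr =>
      refine (@normal_form_eq _ _ _ _ _ _ hopf_op_sem _ _ s t l r pl pr _);
      vm_compute; reflexivity
    end end
  end.

(** The comodule-algebra axioms apply Δ1 to the second factor of [m1] and Δ2 to the first factor of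
    [m2]; these coproducts form the inner [DeltaB]. *)
Lemma phi12_mul :
  phi12 D ∘ (m1 ⊗ m2) = mapQ D ∘ (id1 ⊗ DeltaB D ⊗ id2).
Proof.
rewrite /mapQ /DeltaB.
diagram ((structural, phi12_unfold,
    comodule_algebra_l hD, comodule_algebra_r hD), tt)
  ((structural, phi12_unfold), tt).
Qed.

(** Dually, the products in the module-coalgebra axioms land on the two inner outputs and form
    [mB]. *)
Lemma comul_phi21 :
  (Δ1 ⊗ Δ2) ∘ phi21 D = (id1 ⊗ mB D ⊗ id2) ∘ Defs.mapP D.
Proof.
rewrite /Defs.mapP /mB.
diagram ((structural, phi21_unfold,
    module_coalgebra_l hD, module_coalgebra_r hD), tt)
  ((structural, phi21_unfold), tt).
Qed.

(* The right-hand side contains [phi12] again, and becomes a redex of this rule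
   once [phi21] is composed with it; hence the separate stages in
   [Phi_mul_comul]. *)
Lemma comul_phi12_l :
  (Δ2 ⊗ id1) ∘ phi12 D =
  (m2 ⊗ (m2 ∘ (μr ⊗ id2)) ⊗ m1)
  ∘ (id2 ⊗ id2 ⊗ id2 ⊗ wbraid [:: B1] [:: B1; B2] ⊗ id1)
  ∘ (id2 ⊗ wbraid [:: B2; B1] [:: B2] ⊗ id1 ⊗ id2 ⊗ id1)
  ∘ (id2 ⊗ νl ⊗ id2 ⊗ id1 ⊗ phi12 D)
  ∘ (νl ⊗ id2 ⊗ Δ1 ⊗ id2) ∘ (id1 ⊗ νr ⊗ id2) ∘ (id1 ⊗ Δ2).
Proof.
(* Only the given [phi12] is unfolded; the one created by the comodule-coalgebra axiom in the second
   stage stays whole, as on the right-hand side. *)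
diagram ((tt, phi12_unfold),
    ((structural, algebra_coalgebra2 hD, comodule_coalgebra_r hD), tt))
  (structural, tt).
Qed.

(** The mirror image of [comul_phi12_l], with the roles of [B1] and [B2] exchanged. *)
Lemma comul_phi12_r :
  (id2 ⊗ Δ1) ∘ phi12 D =
  (m2 ⊗ (m1 ∘ (id1 ⊗ μl)) ⊗ m1)
  ∘ (id2 ⊗ wbraid [:: B1; B2] [:: B2] ⊗ id1 ⊗ id1 ⊗ id1)
  ∘ (id2 ⊗ id1 ⊗ id2 ⊗ wbraid [:: B1] [:: B2; B1] ⊗ id1)
  ∘ (phi12 D ⊗ id2 ⊗ id1 ⊗ νr ⊗ id1)
  ∘ (id1 ⊗ Δ2 ⊗ id1 ⊗ νr) ∘ (id1 ⊗ νl ⊗ id2) ∘ (Δ1 ⊗ id2).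
Proof.
diagram ((tt, phi12_unfold),
    ((structural, algebra_coalgebra1 hD, comodule_coalgebra_l hD), tt))
  (structural, tt).
Qed.

Local Notation B := [:: B1; B2].

Lemma Phi_comul_mul : DeltaB D ∘ mB D = Phi D (DeltaB D ∘ mB D).
Proof.
have phi12_mul := phi12_mul; have comul_phi21 := comul_phi21.
rewrite /mapQ /DeltaB in phi12_mul; rewrite /Defs.mapP /mB in comul_phi21.
rewrite /Phi /mapL /mapL' /mapR /mapR' /mapQ /Defs.mapP /DeltaB /mB.
(* The stages expand the coproducts of products, then rewrite [K], then [K']. The [phi12] and
   [phi21] left whole are those of the inner copy. *)
diagram ((tt, algebra_coalgebra1 hD, algebra_coalgebra2 hD),
    ((tt, phi12_mul), ((tt, comul_phi21), tt)))
  (tt, tt).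
Qed.

Lemma Phi_mul_comul (f := (mB D ⊗ mB D) ∘ (wid B ⊗ wbraid B B ⊗ wid B)
    ∘ (DeltaB D ⊗ DeltaB D)) : f = Phi D f.
Proof.
rewrite /f /Phi /mapL /mapL' /mapR /mapR' /mapQ /Defs.mapP /DeltaB /mB.
(* Unfolding [phi21] puts Δ2 on the first output of one [phi12] and Δ1 on the second output of the
   other, where the second stage applies. The last stage also unfolds the [phi21] created by the
   module-algebra axioms. *)
diagram ((tt, phi21_unfold), ((tt, comul_phi12_l, comul_phi12_r),
   ((structural, phi21_unfold, module_algebra_r hD, module_algebra_l hD), tt)))
  ((structural, phi21_unfold), tt).
Qed.

End HopfDatum.

Theorem proposition2p9 (C : strict_braided) (splitC : idempotents_split C)
    (B1 B2 : C) (D : hopf_data B1 B2) (hD : is_hopf_datum D) :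
  let B := [:: B1; B2] in
  let f1 : whom (B ++ B) (B ++ B) := DeltaB D ∘ mB D in
  let f2 : whom (B ++ B) (B ++ B) :=
    (mB D ⊗ mB D) ∘ (wid B ⊗ wbraid B B ⊗ wid B) ∘ (DeltaB D ⊗ DeltaB D) in
  f1 = Phi D f1 /\ f2 = Phi D f2.
Proof. by split; [apply: Phi_comul_mul | apply: Phi_mul_comul]. Qed.
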